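(* Let $m\ge 3$ and let $1=c_1\ge c_2\ge\cdots\ge c_{m-1}\ge 0$ be given real numbers. Let $A$ be the set of all $m!$ permutations of $1,\ldots,m$, let $p=m(m-1)/2+1$, and for a design measure $w$ on $A$ let $M(w)=\sum_{a\in A}w(a)x(a)x(a)^T$ be its $p\times p$ moment matrix, with $x(a)$ as defined in the context. Let $w_0$ be the uniform design measure, $w_0(a)=1/m!$ for all $a\in A$. Then $w_0$ is $\phi$-optimal for every optimality criterion $\phi(\cdot)$ which is concave and signed permutation invariant; that is, for every such $\phi$ and every design measure $w$ on $A$, $\phi\{M(w_0)\}\ge\phi\{M(w)\}$.
   Context: Treatments: $A$ is the set of all orderings $a=a_1\ldots a_m$ of the components $1,\ldots,m$ (so $|A|=m!$). $S$ is the set of all pairs $ij$ with $1\le i<j\le m$, listed in the order $12,13,\ldots,1m,23,\ldots,(m-1)m$. For $a\in A$ and $ij\in S$, the distance between $i$ and $j$ in $a$ is $h(ij,a)=|k-l|$, where $a_k=i$, $a_l=j$. Define $z_{ij}(a)=c_{h(ij,a)}$ if $i$ precedes $j$ in $a$, and $z_{ij}(a)=-c_{h(ij,a)}$ if $j$ precedes $i$ in $a$. Let $z(a)=(z_{ij}(a))_{ij\in S}$, a column vector of length $q=m(m-1)/2$, and $x(a)=[1,z(a)^T]^T$, a column vector of length $p=q+1$. A design measure is a family $w=\{w(a):a\in A\}$ of nonnegative reals with $\sum_{a\in A}w(a)=1$. Let $\mathcal{M}$ be the class of $p\times p$ (symmetric) nonnegative definite matrices. An optimality criterion is a function $\phi$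 on $\mathcal{M}$ with values in $\mathbb{R}\cup\{-\infty\}$ (the value $-\infty$ being allowed, e.g. for $\log\det M$ or $-\mathrm{tr}(M^{-1})$ at singular $M$). It is concave if it is concave over $\mathcal{M}$, and signed permutation invariant if $\phi(R^TMR)=\phi(M)$ for every $M\in\mathcal{M}$ and every signed permutation matrix $R$ of order $p$, i.e. every square matrix having exactly one nonzero entry in each row and column, each nonzero entry being $1$ or $-1$. A design measure is $\phi$-optimal if it maximizes $\phi\{M(w)\}$ among all design measures $w$. *)

(* Defs.v *)
From HB Require Import structures.
From mathcomp Require Import all_boot all_order all_algebra all_fingroup.
From mathcomp Require Import constructive_ereal reals.

Set Implicit Arguments.
Unset Strict Implicit.
Unset Printing Implicit Defensive.

Import Order.TTheory GRing.Theory Num.Theory.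

Local Open Scope ring_scope.

(* The components 1, ..., m are represented by 0, ..., m-1 : 'I_m.  An ordering
   a_1 ... a_m is the permutation a : 'S_m sending a position k to the component
   a_k that occupies it, so that the position of i is the image of i by the
   inverse permutation. *)
Definition position (m : nat) (a : 'S_m) (i : 'I_m) : 'I_m := (a^-1)%g i.

Definition pairs (m : nat) : {set 'I_m * 'I_m} :=
  [set ij : 'I_m * 'I_m | (ij.1 < ij.2)%N].

Definition npairs (m : nat) : nat := (m * (m - 1))./2.

Definition nparams (m : nat) : nat := (1 + npairs m)%N.

Lemma card_pairs (m : nat) : #|pairs m| = npairs m.
Proof.
rewrite /npairs subn1 -bin2 -bin2_sum big_mkord -sum1dep_card.
rewrite -(pair_big_dep predT (fun i j : 'I_m => (i < j)%N) (fun _ _ => 1%N)) /=.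
rewrite (exchange_big_dep predT) //=; apply: eq_bigr => j _.
rewrite (big_ord_narrow (F := fun=> 1%N) (ltnW (ltn_ord j))).
by rewrite sum1_card card_ord.
Qed.

(* Products of finite types are enumerated lexicographically, hence so is the
   set of pairs: 12, 13, ..., 1m, 23, ..., (m-1)m. *)
Definition pair_of_index (m : nat) (k : 'I_(npairs m)) : 'I_m * 'I_m :=
  enum_val (cast_ord (esym (card_pairs m)) k).

Definition dist (m : nat) (ij : 'I_m * 'I_m) (a : 'S_m) : nat :=
  `|(position a ij.1)%:Z - (position a ij.2)%:Z|%N.

Section Model.
Variables (R : realType) (m : nat) (c : nat -> R).

Definition zcoord (ij : 'I_m * 'I_m) (a : 'S_m) : R :=
  if (position a ij.1 < position a ij.2)%N then c (dist ij a)
  else - c (dist ij a).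

Definition zvec (a : 'S_m) : 'cV[R]_(npairs m) :=
  \col_(k < npairs m) zcoord (pair_of_index k) a.

Definition xvec (a : 'S_m) : 'cV[R]_(nparams m) := col_mx (1%:M : 'M_1) (zvec a).

Definition design_measure (w : 'S_m -> R) : Prop :=
  (forall a, 0 <= w a) /\ \sum_(a : 'S_m) w a = 1.

Definition moment_matrix (w : 'S_m -> R) : 'M[R]_(nparams m) :=
  \sum_(a : 'S_m) w a *: (xvec a *m (xvec a)^T).

Definition uniform_design : 'S_m -> R := fun=> (m`!)%:R^-1.

Definition phi_optimal (phi : 'M[R]_(nparams m) -> \bar R) (w0 : 'S_m -> R) : Prop :=
  design_measure w0 /\
  forall w, design_measure w ->
    (phi (moment_matrix w) <= phi (moment_matrix w0))%E.

End Model.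

Section Criteria.
Variables (R : realType) (n : nat).

Definition nonneg_definite (M : 'M[R]_n) : Prop :=
  M^T = M /\ forall v : 'cV[R]_n, 0 <= (v^T *m M *m v) 0 0.

Definition signed_permutation_matrix (S : 'M[R]_n) : Prop :=
  [/\ forall i, exists! j, S i j != 0,
      forall j, exists! i, S i j != 0
    & forall i j, S i j != 0 -> S i j = 1 \/ S i j = -1].

(* A criterion is only meaningful on the nonnegative definite matrices; its
   values elsewhere are irrelevant and left unconstrained. *)
Definition optimality_criterion (phi : 'M[R]_n -> \bar R) : Prop :=
  forall M, nonneg_definite M -> phi M <> +oo%E.

(* As 0 * -oo = 0 in \bar R, the endpoints t = 0 and t = 1 impose nothing. *)
Definition concave_criterion (phi : 'M[R]_n -> \bar R) : Prop :=
  forall (M N : 'M[R]_n) (t : R),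
    nonneg_definite M -> nonneg_definite N -> 0 <= t <= 1 ->
    (t%:E * phi M + (1 - t)%R%:E * phi N <= phi (t *: M + (1 - t) *: N)%R)%E.

Definition signed_permutation_invariant (phi : 'M[R]_n -> \bar R) : Prop :=
  forall M S : 'M[R]_n,
    nonneg_definite M -> signed_permutation_matrix S ->
    phi (S^T *m M *m S) = phi M.

End Criteria.

(* Main.v *)
Require Import Defs.
From HB Require Import structures.
From mathcomp Require Import all_boot all_order all_algebra all_fingroup.
From mathcomp Require Import constructive_ereal reals.

Import Order.TTheory GRing.Theory Num.Theory.

Local Open Scope ring_scope.

(** The result is an averaging argument over relabellings of the components.
    Relabelling the components by a permutation [s] permutes the pairs [ij] up
    to orientation, and reversing a pair changes the sign of its coordinate, so
    relabelling acts on the vectors [x(a)] by a signed permutation matrix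
    ([relabel_mxP], [relabel_xvec]).  Hence the moment matrix of a relabelled
    design is a conjugate of [M(w)] of the kind under which [phi] is invariant
    ([moment_matrix_relabel]).

    The permutations act simply transitively on the orderings, so the average
    over all [s] of the relabelled designs is the uniform design whatever [w] is
    ([mean_relabelled_moment_matrix]).  Thus [M(w_0)] is a mean of matrices at
    which [phi] takes the same value [phi (M(w))], and concavity gives
    [phi (M(w)) <= phi (M(w_0))].  Since [phi] may take the value [-oo],
    concavity is used in the form that the superlevel sets of [phi] at finite
    levels are convex ([superlevel_convex]), hence closed under finite means
    ([convex_mean]). *)

(** * Convex sets and superlevel sets *)

(** Peeling off the head of [x :: s] writes the mean of [n + 1] points as the
    convex combination of [x] and the mean of the other [n] points with weights
    [1 / (n + 1)] and [n / (n + 1)]. *)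
Lemma convex_mean (R : realType) (V : lmodType R) (C : V -> Prop) (s : seq V) :
    (forall x y (t : R), C x -> C y -> 0 <= t <= 1 -> C (t *: x + (1 - t) *: y)) ->
    (0 < size s)%N -> (forall x, x \in s -> C x) ->
  C ((size s)%:R^-1 *: \sum_(x <- s) x).
Proof.
move=> Cconv; case: s => // x0 s _; elim: s x0 => [|y s IHs] x Cs.
  by rewrite big_seq1 invr1 scale1r; apply: Cs; rewrite mem_head.
set n := size (y :: s).
have n_gt0 : 0 < n%:R :> R by rewrite ltr0n.
have n1_gt0 : 0 < n.+1%:R :> R by rewrite ltr0n.
have Cx : C x by apply: Cs; rewrite mem_head.
have Cmean : C (n%:R^-1 *: \sum_(z <- y :: s) z).
  by apply: IHs => z zs; apply: Cs; rewrite inE zs orbT.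
have weight : (1 - n.+1%:R^-1) * n%:R^-1 = n.+1%:R^-1 :> R.
  rewrite -[X in X - _](divff (lt0r_neq0 n1_gt0)) -[X in _ - X]mul1r -mulrBl.
  by rewrite -natr1 addrK mulrAC divff ?mul1r // lt0r_neq0.
have := Cconv _ _ n.+1%:R^-1 Cx Cmean.
rewrite scalerA weight -scalerDr [in X in X -> _]big_cons => H.
rewrite /= big_cons big_cons; apply: H.
by rewrite invr_ge0 ler0n invf_le1 ?ler1n.
Qed.

Section NonnegDefinite.
Set Implicit Arguments.
Unset Strict Implicit.
Variables (R : realType) (n : nat).
Implicit Types (M N : 'M[R]_n).

Lemma nonneg_definite0 : nonneg_definite (0 : 'M[R]_n).
Proof. by split=> [|v]; rewrite ?trmx0 // mulmx0 mul0mx mxE. Qed.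

Lemma nonneg_definiteD M N :
  nonneg_definite M -> nonneg_definite N -> nonneg_definite (M + N).
Proof.
move=> [Msym Mge0] [Nsym Nge0]; split=> [|v].
  by rewrite linearD /= Msym Nsym.
by rewrite mulmxDr mulmxDl mxE addr_ge0.
Qed.

Lemma nonneg_definiteZ (t : R) M :
  0 <= t -> nonneg_definite M -> nonneg_definite (t *: M).
Proof.
move=> t_ge0 [Msym Mge0]; split=> [|v]; first by rewrite linearZ /= Msym.
by rewrite -scalemxAr -scalemxAl mxE mulr_ge0.
Qed.

Lemma nonneg_definite_outer (x : 'cV[R]_n) : nonneg_definite (x *m x^T).
Proof.
split=> [|v]; first by rewrite trmx_mul trmxK.
rewrite mulmxA -mulmxA; have -> : x^T *m v = (v^T *m x)^T.
  by rewrite trmx_mul trmxK.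
by rewrite mxE big_ord1 [X in _ * X]mxE -expr2 sqr_ge0.
Qed.

Lemma superlevel_convex (phi : 'M[R]_n -> \bar R) (r : R) M N (t : R) :
    concave_criterion phi ->
    nonneg_definite M /\ (r%:E <= phi M)%E ->
    nonneg_definite N /\ (r%:E <= phi N)%E -> 0 <= t <= 1 ->
  nonneg_definite (t *: M + (1 - t) *: N) /\
  (r%:E <= phi (t *: M + (1 - t) *: N)%R)%E.
Proof.
move=> phi_concave [Mnnd rM] [Nnnd rN] t01; have /andP[t_ge0 t_le1] := t01.
have t'_ge0 : 0 <= 1 - t by rewrite subr_ge0.
split; first by apply: nonneg_definiteD; apply: nonneg_definiteZ.
apply: le_trans (phi_concave _ _ _ Mnnd Nnnd t01).
have {1}-> : r%:E = (t%:E * r%:E + (1 - t)%R%:E * r%:E)%E.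
  by rewrite -!EFinM -EFinD -mulrDl addrC subrK mul1r.
by apply: leeD; apply: lee_wpmul2l; rewrite ?lee_fin.
Qed.

End NonnegDefinite.

(** * Unordered pairs and their orientations *)

Section Pairs.
Set Implicit Arguments.
Unset Strict Implicit.
Variable m : nat.
Implicit Types (p q : 'I_m * 'I_m) (k l : 'I_(npairs m)) (s a : 'S_m).

Definition swap_pair p : 'I_m * 'I_m := (p.2, p.1).

Definition relabel_pair s p : 'I_m * 'I_m := (s p.1, s p.2).

Lemma swap_pairK : involutive swap_pair.
Proof. by case. Qed.

Lemma relabel_pair_neq s p :
  p.1 != p.2 -> (relabel_pair s p).1 != (relabel_pair s p).2.
Proof. by move=> pN; rewrite /= (inj_eq perm_inj). Qed.

Lemma eq_relabel_pair s p q :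
  (p == relabel_pair s q) = (q == relabel_pair s^-1%g p).
Proof.
case: p q => [p1 p2] [q1 q2]; apply/eqP/eqP; rewrite /relabel_pair /=.
  by case=> -> ->; rewrite !permK.
by case=> -> ->; rewrite !permKV.
Qed.

Lemma eq_swap_relabel_pair s p q :
  (p == swap_pair (relabel_pair s q)) = (q == swap_pair (relabel_pair s^-1%g p)).
Proof.
by rewrite -[RHS](inj_eq (inv_inj swap_pairK)) swap_pairK -eq_relabel_pair.
Qed.

Lemma pair_of_index_lt k : ((pair_of_index k).1 < (pair_of_index k).2)%N.
Proof.
have := enum_valP (cast_ord (esym (card_pairs m)) k).
by rewrite inE.
Qed.

Lemma pair_of_index_neq k : (pair_of_index k).1 != (pair_of_index k).2.
Proof. by have := pair_of_index_lt k; rewrite ltn_neqAle => /andP[]. Qed.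

Lemma pair_of_index_inj : injective (@pair_of_index m).
Proof. by move=> k l /enum_val_inj /cast_ord_inj. Qed.

Lemma pair_of_index_surj p : (p.1 < p.2)%N -> exists k, pair_of_index k = p.
Proof.
move=> plt; have pP : p \in pairs m by rewrite inE.
exists (cast_ord (card_pairs m) (enum_rank_in pP p)).
by rewrite /pair_of_index cast_ordK enum_rankK_in.
Qed.

Lemma pair_of_index_unique p : p.1 != p.2 ->
  exists! k, (pair_of_index k == p) || (pair_of_index k == swap_pair p).
Proof.
have lt_unique q : (q.1 < q.2)%N ->
    exists! k, (pair_of_index k == q) || (pair_of_index k == swap_pair q).
  move=> qlt; have [k kq] := pair_of_index_surj qlt.
  exists k; split=> [|l]; first by rewrite kq eqxx.
  case/orP=> /eqP lq; first by apply: pair_of_index_inj; rewrite kq.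
  by have := pair_of_index_lt l; rewrite lq ltnNge ltnW.
move=> pN; case: (ltngtP p.1 p.2) => [/lt_unique // | gt_p | eq_p].
  have [k [kP kU]] := lt_unique (swap_pair p) gt_p; exists k.
  rewrite swap_pairK in kP kU; split=> [|l]; first by rewrite orbC.
  by rewrite orbC => /kU.
by rewrite (val_inj eq_p) eqxx in pN.
Qed.

End Pairs.

(** * Relabelling acts by signed permutation matrices *)

Section Relabelling.
Set Implicit Arguments.
Unset Strict Implicit.
Variables (R : realType) (m : nat) (c : nat -> R).
Implicit Types (p q : 'I_m * 'I_m) (k l : 'I_(npairs m)) (s a : 'S_m).

(** For ordered pairs of distinct components: 1 if [p] and [q] agree, -1 if they
    are opposite orientations of one pair, 0 if they are different pairs. *)
Definition pair_sign p q : R := (p == q)%:R - (p == swap_pair q)%:R.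

Lemma pair_sign_relabel s p q :
  pair_sign p (relabel_pair s q) = pair_sign q (relabel_pair s^-1%g p).
Proof. by rewrite /pair_sign eq_relabel_pair eq_swap_relabel_pair. Qed.

Lemma pair_sign_id p : p.1 != p.2 -> pair_sign p p = 1.
Proof.
move=> pN; rewrite /pair_sign eqxx; case: eqP => [eq_p|_]; last by rewrite subr0.
by move: pN; rewrite eq_p /= {1}eq_p /= eqxx.
Qed.

Lemma pair_sign_swap p : p.1 != p.2 -> pair_sign (swap_pair p) p = -1.
Proof.
move=> pN; rewrite /pair_sign eqxx; case: eqP => [eq_p|_]; last by rewrite sub0r.
by case: p pN eq_p => i j /= + [eq_ij _]; rewrite eq_ij eqxx.
Qed.

Lemma pair_sign_neq0 p q : p.1 != p.2 ->
  (pair_sign p q != 0) = (p == q) || (p == swap_pair q).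
Proof.
move=> pN; have [<- | pq] := eqVneq p q; first by rewrite pair_sign_id ?oner_neq0.
have [p_sq | psq] := eqVneq p (swap_pair q).
  by rewrite p_sq pair_sign_swap ?oppr_eq0 ?oner_neq0 // eq_sym; move: pN; rewrite p_sq.
by rewrite /pair_sign (negPf pq) (negPf psq) subr0 eqxx.
Qed.

Lemma pair_sign_pm1 p q : pair_sign p q != 0 -> pair_sign p q = 1 \/ pair_sign p q = -1.
Proof.
rewrite /pair_sign; case: (p == q); case: (p == _); rewrite ?subrr ?eqxx //.
  by rewrite subr0; left.
by rewrite sub0r; right.
Qed.

Lemma zcoord_swap p a : p.1 != p.2 -> zcoord c (swap_pair p) a = - zcoord c p a.
Proof.
move=> pN; rewrite /zcoord /dist /= distnC.
have : position a p.1 != position a p.2 by rewrite (inj_eq perm_inj).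
by rewrite -val_eqE /=; case: ltngtP => //=; rewrite opprK.
Qed.

Lemma zcoord_relabel s p a : zcoord c (relabel_pair s p) (a * s)%g = zcoord c p a.
Proof. by rewrite /zcoord /dist /position /= invMg !permM !permK. Qed.

(** Exactly one orientation of [p] is listed among the pairs [ij] with [i < j];
    it is the only nonzero term, with sign -1 if [p] is the other orientation. *)
Lemma zcoord_pair_sign p a : p.1 != p.2 ->
  zcoord c p a =
  \sum_(k < npairs m) pair_sign (pair_of_index k) p * zcoord c (pair_of_index k) a.
Proof.
move=> pN; have [k [kP kU]] := pair_of_index_unique pN.
rewrite (bigD1 k) //= big1 ?addr0 => [|l lk]; last first.
  apply/eqP; rewrite mulf_eq0; apply/orP; left.
  rewrite -[_ == 0]negbK pair_sign_neq0 ?pair_of_index_neq //.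
  by apply: contraNN lk => /kU ->.
case/orP: kP => /eqP ->; first by rewrite pair_sign_id ?mul1r.
by rewrite pair_sign_swap // zcoord_swap // mulrNN mul1r.
Qed.

Definition relabel_pairs_mx s : 'M[R]_(npairs m) :=
  \matrix_(k, l) pair_sign (pair_of_index k) (relabel_pair s (pair_of_index l)).

Definition relabel_mx s : 'M[R]_(nparams m) :=
  block_mx (1%:M : 'M_1) 0 0 (relabel_pairs_mx s).

Lemma tr_relabel_mx s : (relabel_mx s)^T = relabel_mx s^-1%g.
Proof.
rewrite /relabel_mx tr_block_mx trmx1 !trmx0; congr block_mx.
by apply/matrixP=> k l; rewrite !mxE pair_sign_relabel.
Qed.

Lemma relabel_pairs_mx_row s k : exists! l, relabel_pairs_mx s k l != 0.
Proof.
have kN := pair_of_index_neq k.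
have [l [lP lU]] := pair_of_index_unique (relabel_pair_neq s^-1%g kN).
exists l; split=> [|l']; rewrite mxE pair_sign_neq0 //.
  by rewrite eq_relabel_pair eq_swap_relabel_pair.
by rewrite eq_relabel_pair eq_swap_relabel_pair => /lU.
Qed.

Lemma relabel_mx_row s i : exists! j, relabel_mx s i j != 0.
Proof.
case: (split_ordP i) => [i1 | k] ->.
  exists (lshift _ i1); split=> [|j]; first by rewrite block_mxEul !ord1 mxE oner_neq0.
  case: (split_ordP j) => [j1 -> _|l ->]; first by rewrite !ord1.
  by rewrite block_mxEur mxE eqxx.
have [l [lP lU]] := relabel_pairs_mx_row s k.
exists (rshift _ l); split=> [|j]; first by rewrite block_mxEdr.
case: (split_ordP j) => [j1 ->|l' ->]; first by rewrite block_mxEdl mxE eqxx.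
by rewrite block_mxEdr => /lU ->.
Qed.

(** Transposing [relabel_mx s] gives [relabel_mx s^-1], so the condition on the
    columns is the condition on the rows for the inverse relabelling. *)
Lemma relabel_mxP s : signed_permutation_matrix (relabel_mx s).
Proof.
split=> [|j|i j]; first exact: relabel_mx_row.
  have [i [iP iU]] := relabel_mx_row s^-1%g j.
  exists i; split=> [|i']; first by move: iP; rewrite -tr_relabel_mx mxE.
  by move=> i'P; apply: iU; rewrite -tr_relabel_mx mxE.
case: (split_ordP i) => [i1 | k] ->; case: (split_ordP j) => [j1 | l] ->.
- by rewrite block_mxEul !ord1 mxE; left.
- by rewrite block_mxEur mxE eqxx.
- by rewrite block_mxEdl mxE eqxx.
- by rewrite block_mxEdr mxE; apply: pair_sign_pm1.
Qed.

Lemma relabel_xvec s a : (relabel_mx s)^T *m xvec c a = xvec c (a * s^-1)%g.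
Proof.
rewrite /relabel_mx tr_block_mx trmx1 !trmx0 /xvec mul_block_col.
rewrite !mul0mx mul1mx addr0 add0r; congr col_mx.
apply/matrixP=> l j; rewrite !mxE.
have lN := relabel_pair_neq s (pair_of_index_neq l).
rewrite -(zcoord_relabel s) mulgKV (zcoord_pair_sign _ lN).
by apply: eq_bigr => k _; rewrite !mxE.
Qed.

(** * Moment matrices of relabelled designs *)

Implicit Type w : 'S_m -> R.

Lemma moment_matrix_nonneg_definite w :
  (forall a, 0 <= w a) -> nonneg_definite (moment_matrix c w).
Proof.
move=> w_ge0; apply: (big_ind (@nonneg_definite R (nparams m))) => [||a _].
- exact: nonneg_definite0.
- exact: nonneg_definiteD.
- by apply: nonneg_definiteZ => //; apply: nonneg_definite_outer.
Qed.

(** Substituting [a * s^-1] for [a] moves the relabelling from the weights to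
    the vectors [x(a)], on which it acts linearly by [relabel_xvec]. *)
Lemma moment_matrix_relabel w s :
  moment_matrix c (fun a => w (a * s)%g) =
  (relabel_mx s)^T *m moment_matrix c w *m relabel_mx s.
Proof.
rewrite /moment_matrix (reindex_inj (mulIg s^-1%g)) mulmx_sumr mulmx_suml.
apply: eq_bigr => a _; rewrite mulgKV -scalemxAr -scalemxAl -relabel_xvec.
by rewrite trmx_mul trmxK !mulmxA.
Qed.

(** For a fixed ordering [a], the products [a * s] run once through all
    orderings, so each [x(a) x(a)^T] receives total weight 1. *)
Lemma mean_relabelled_moment_matrix w : \sum_a w a = 1 ->
  (m`!)%:R^-1 *: \sum_(s : 'S_m) moment_matrix c (fun a => w (a * s)%g) =
  moment_matrix c (@uniform_design R m).
Proof.
move=> w1; rewrite /moment_matrix exchange_big /= scaler_sumr.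
apply: eq_bigr => a _; rewrite -scaler_suml.
have -> : \sum_(s : 'S_m) w (a * s)%g = 1.
  by rewrite -w1 [RHS](reindex_inj (mulgI a)).
by rewrite scale1r.
Qed.

Lemma uniform_design_measure : design_measure (@uniform_design R m).
Proof.
split=> [a|]; first by rewrite /uniform_design invr_ge0 ler0n.
rewrite sumr_const card_Sn -[_ *+ _]mulr_natl divff //.
by rewrite pnatr_eq0 -lt0n fact_gt0.
Qed.

End Relabelling.

(** * Optimality of the uniform design *)

Theorem theorem1 (R : realType) (m : nat) (c : nat -> R)
    (hm : (3 <= m)%N)
    (c1 : c 1%N = 1)
    (c_noninc : forall h : nat, (1 <= h)%N -> (h.+1 <= m - 1)%N ->
       c h.+1 <= c h)
    (c_ge0 : 0 <= c (m - 1)%N)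
    (phi : 'M[R]_(nparams m) -> \bar R)
    (phi_crit : optimality_criterion phi)
    (phi_concave : concave_criterion phi)
    (phi_inv : signed_permutation_invariant phi) :
  phi_optimal c phi (@uniform_design R m).
Proof.
split=> [|w [w_ge0 w1]]; first exact: uniform_design_measure.
have w_nnd := moment_matrix_nonneg_definite c w_ge0.
case Ew : (phi (moment_matrix c w)) => [r| |]; last exact: leNye.
  pose Ms := [seq moment_matrix c (fun a => w (a * s)%g) | s : 'S_m].
  have size_Ms : size Ms = m`! by rewrite size_map -cardT card_Sn.
  have := @convex_mean _ _
    (fun M => nonneg_definite M /\ (r%:E <= phi M)%E) Ms _ _ _.
  rewrite size_Ms big_map big_enum (mean_relabelled_moment_matrix c w1).
  case=> // [M N t| |M].
  - exact: superlevel_convex.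
  - exact: fact_gt0.
  case/imageP=> s _ ->; split; first exact: moment_matrix_nonneg_definite.
  rewrite moment_matrix_relabel phi_inv ?Ew //; exact: relabel_mxP.
by have := phi_crit _ w_nnd; rewrite Ew.
Qed.
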